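(* Let $k, k', \ell$, and $t$ be positive integers such that $k \geq k' \geq t+1$ and $\ell \geq 2$. Let $n$ be an integer satisfying $n \geq \frac{k^{2}\ell^{4}}{2}\binom{2k}{t+1}\binom{k}{t}+t$. Suppose that two families $\mathcal{F} \subseteq \binom{[n]}{k}$ and $\mathcal{G} \subseteq \binom{[n]}{k'}$ are $\ell$-weakly cross $t$-intersecting. Then \[ |\mathcal{F}| \cdot |\mathcal{G}| \le \binom{n-t}{k-t} \binom{n-t}{k'-t}. \] Moreover, equality holds only if $\mathcal{F}=\{F\in \binom{[n]}{k}\colon T\subseteq F\}$ and $\mathcal{G}=\{G\in \binom{[n]}{k'}\colon T\subseteq G\}$ for some $t$-subset $T$ of $[n]$.
   Context: $[n]=\{1,2,\dots,n\}$ and $\binom{[n]}{k}$ denotes the set of all $k$-element subsets of $[n]$. Families $\mathcal{F}\subseteq \binom{[n]}{k}$ and $\mathcal{G}\subseteq \binom{[n]}{k'}$ are called $\ell$-weakly cross $t$-intersecting if $\sum_{1\leq i,j\leq \ell}|F_{i}\cap G_{j}|\geq \ell^{2}t-\ell+1$ (the sum being over all $\ell^2$ pairs $(i,j)$) for every choice of $\ell$ distinct members $F_{1},\ldots,F_{\ell}\in\mathcal{F}$ and $\ell$ distinct members $G_{1},\ldots,G_{\ell}\in\mathcal{G}$.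
   Formalization: The formal theorem also assumes |F| ≥ ℓ and |G| ≥ ℓ; otherwise the intersection condition is vacuous and the bound can fail, e.g. k=k'=3, t=2, ℓ=2, |F|=1, G all 3-subsets gives C(n,3) > (n-2)^2. *)

(* Defs.v *)
From HB Require Import structures.
From mathcomp Require Import all_boot all_order all_algebra.

Set Implicit Arguments.
Unset Strict Implicit.
Unset Printing Implicit Defensive.

(* The ground set [n] is modelled by 'I_n = {0, ..., n-1}. *)
Definition ksubsets (n k : nat) : {set {set 'I_n}} :=
  [set A : {set 'I_n} | #|A| == k].

(* The l distinct members of each family are given as injective l-indexed
   families.  The bound  sum >= l^2 t - l + 1  is written with l moved to the
   other side, because subtraction on nat is truncated.  The condition is
   vacuous as soon as one of the two families has fewer than l members. *)
Definition weakly_cross_intersecting (n l t : nat)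
    (FF GG : {set {set 'I_n}}) : Prop :=
  forall F G : 'I_l -> {set 'I_n},
    injective F -> injective G ->
    (forall i, F i \in FF) -> (forall j, G j \in GG) ->
    l ^ 2 * t + 1 <= \sum_(i < l) \sum_(j < l) #|F i :&: G j| + l.

Definition kstar (n k : nat) (T : {set 'I_n}) : {set {set 'I_n}} :=
  [set A in ksubsets n k | T \subset A].

(* Main.v *)
Require Import Defs.
From HB Require Import structures.
From mathcomp Require Import all_boot all_order all_algebra.
From mathcomp Require Import zify ring lra.
Import Order.TTheory GRing.Theory Num.Theory.

(** Call [t - |F :&: G|] the deficiency of a pair.  The hypothesis says that
    [l] members of [FF] and [l] members of [GG] have total deficiency at most
    [l - 1].  Hence, for fixed distinct [F_1, ..., F_l] in [FF], fewer than [l]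
    members [G] of [GG] can have positive total deficiency against them
    ([card_deficient_lt]): [l] such members would already cost [l].

    This has two consequences.  Write [A] for ['C(2k, t+1)], [N] for
    ['C(n-t-1, k-t-1)] and [N'] for ['C(n-t-1, k'-t-1)].
    - All but [l - 1] members of [GG] meet some [F_i] in at least [t] points,
      so some [t]-set lies in a positive proportion, about [1 / (l 'C(k, t))],
      of [GG] ([exists_popular_subset]); in particular [|GG|] is at most about
      [l 'C(k, t)] times the size of a star.
    - If [X] and [Y] are distinct members of [FF], all but
      [(l - 1) (1 + A N')] members [G] of [GG] satisfy [G :&: X = G :&: Y], a
      set of size [t] ([card_distinguishing_le]).
    Both statements hold with the two families, and [k] and [k'], exchanged.

    Suppose [|FF| |GG|] is at least the product of the star sizes.  As each
    factor is bounded above by the first consequence, each is also bounded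
    below, and for [n] this large the bound is at least [l^2 A N] for [FF]
    and [l^2 A N'] for [GG] ([card_family_ge]), which is more than all the
    exceptional sets together.  The conclusion is then structural
    ([cross_families_in_stars]).  Take a [t]-set [T] that is popular in [FF].
    So many members of [FF] contain [T] that two of them, [F1] and [F2],
    meet exactly in [T].  Almost every [G] satisfies
    [G :&: F1 = G :&: F2], which must then be [T].  For any other [F0] in [FF]
    almost every [G] also satisfies [G :&: F0 = G :&: F1 = T], so [F0] contains
    [T].  Exchanging the roles of the families, every [G0] in [GG] contains
    [T].  Both families lie in stars with centre [T], which gives the bound and
    forces equality to be attained by full stars only. *)

(** * Finite sets and stars *)

(** The prescribed values [x] and [y] let a chosen pair of members be completed
    to an [l]-tuple to which the intersection condition applies. *)
Lemma exists_injective_tuple (T : finType) (S : {set T}) (x y : T) (l : nat) :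
  x \in S -> y \in S -> x != y -> 2 <= l -> l <= #|S| ->
  exists F : 'I_l -> T,
    [/\ injective F, forall i, F i \in S & exists i j, [/\ i != j, F i = x & F j = y]].
Proof.
move=> xS yS xy l2 lS.
have : l - 2 <= #|S :\: [set x; y]|.
  rewrite cardsD leq_sub //; apply: leq_trans (subset_leq_card (subsetIr _ _)) _.
  by rewrite cards2 xy.
case/card_geqP=> s [us ss sS].
have xs : x \notin s by apply/negP=> /sS; rewrite !inE eqxx.
have ys : y \notin s by apply/negP=> /sS; rewrite !inE eqxx orbT.
have su : uniq [:: x, y & s] by rewrite /= inE negb_or xy xs ys.
have sz : size [:: x, y & s] = l by rewrite /= ss; lia.
exists (fun i => nth x [:: x, y & s] i); split.
- move=> i j /eqP; rewrite nth_uniq ?sz //; first by move/eqP/val_inj.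
- move=> i; have : nth x [:: x, y & s] i \in [:: x, y & s] by rewrite mem_nth ?sz.
  by rewrite !inE => /or3P [/eqP->|/eqP->|/sS] //; rewrite inE => /andP[].
- by exists (Ordinal (ltnW l2)), (Ordinal l2).
Qed.

Lemma exists_of_card_failing_lt (T : finType) (S : {set T}) (P : pred T) :
  #|[set x in S | ~~ P x]| < #|S| -> exists2 x, x \in S & P x.
Proof.
move=> lt; apply/exists_inP; apply: contraLR lt; rewrite negb_exists_in -leqNgt.
move/forall_inP=> nP; apply: subset_leq_card.
by apply/subsetP=> x xS; rewrite inE xS nP.
Qed.

(** Deleting [T] is a bijection from the star of [T] onto the sets of size
    [k - #|T|] in the complement of [T]; the proof uses its inverse. *)
Lemma card_kstar n k (T : {set 'I_n}) :
  #|T| <= k -> #|kstar k T| = 'C(n - #|T|, k - #|T|).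
Proof.
move=> Tk.
have -> : kstar k T =
  (fun A => A :|: T) @: [set A : {set 'I_n} | A \subset ~: T & #|A| == k - #|T|].
  apply/setP=> A; rewrite !inE; apply/andP/imsetP.
    case=> /eqP Ak TA; exists (A :\: T).
      by rewrite inE subsetDr cardsD (setIidPr TA) Ak eqxx.
    by rewrite -{1}(setID A T) (setIidPr TA) setUC.
  case=> B; rewrite inE => /andP[BT /eqP Bk] ->; rewrite subsetUr; split=> //.
  rewrite cardsU Bk; move: BT; rewrite -disjoints_subset -setI_eq0 => /eqP->.
  by rewrite cards0 subn0 subnK.
rewrite card_in_imset; last first.
  move=> A B; rewrite !inE => /andP[AT _] /andP[BT _] AB.
  have : (A :|: T) :\: T = (B :|: T) :\: T by rewrite AB.
  by rewrite !setDUl setDv !setU0 !setDE (setIidPl AT) (setIidPl BT).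
by rewrite cards_draws cardsCs setCK card_ord.
Qed.

Lemma card_bigcup_le (I T : finType) (P : pred I) (F : I -> {set T}) :
  #|\bigcup_(i | P i) F i| <= \sum_(i | P i) #|F i|.
Proof.
elim/big_rec2: _ => [|i m A _ IH]; first by rewrite cards0.
by apply: leq_trans (leq_card_setU _ _) _; rewrite leq_add2l.
Qed.

Lemma card_le_sum_containing n (AA UU : {set {set 'I_n}}) :
  (forall A, A \in AA -> exists2 U, U \in UU & U \subset A) ->
  #|AA| <= \sum_(U in UU) #|[set A in AA | U \subset A]|.
Proof.
move=> h.
have sub : AA \subset \bigcup_(U in UU) [set A in AA | U \subset A].
  apply/subsetP=> A AAA; have [U UUU UA] := h A AAA.
  by apply/bigcupP; exists U => //; rewrite inE AAA.
exact: leq_trans (subset_leq_card sub) (card_bigcup_le _ _ _ _).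
Qed.

Lemma exists_subset_card (T : finType) (S : {set T}) r :
  r <= #|S| -> exists2 U : {set T}, U \subset S & #|U| = r.
Proof.
case/card_geqP=> u [uu us uS]; exists [set x in u].
  by apply/subsetP=> x; rewrite inE => /uS.
by rewrite -us cardsE; apply/card_uniqP.
Qed.

(** Each member contains one of the at most ['C(s, r)] subsets of [S] of size
    [r], and the members containing a given one lie in its star. *)
Lemma card_meeting_le n k s r (S : {set 'I_n}) (AA : {set {set 'I_n}}) :
  AA \subset ksubsets n k -> #|S| <= s -> r <= k ->
  (forall A, A \in AA -> r <= #|A :&: S|) ->
  #|AA| <= 'C(s, r) * 'C(n - r, k - r).
Proof.
move=> Ak Ss rk h.
pose UU := [set U : {set 'I_n} | U \subset S & #|U| == r].
have cov A : A \in AA -> exists2 U, U \in UU & U \subset A.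
  move/h/exists_subset_card => [U]; rewrite subsetI => /andP[UA US] Ur.
  by exists U; rewrite // inE US Ur eqxx.
apply: leq_trans (card_le_sum_containing _ _ _ cov) _.
apply: (@leq_trans (\sum_(U in UU) 'C(n - r, k - r))); last first.
  by rewrite sum_nat_const leq_mul2r cards_draws leq_bin2l ?orbT.
apply: leq_sum => U; rewrite inE => /andP[_ /eqP Ur].
rewrite -Ur -card_kstar ?Ur //; apply: subset_leq_card.
by apply/subsetP=> A; rewrite !inE => /andP[/(subsetP Ak)]; rewrite inE => -> ->.
Qed.

(** * Consequences of weak cross intersection *)

Lemma weakly_cross_sym n l t (FF GG : {set {set 'I_n}}) :
  weakly_cross_intersecting l t FF GG -> weakly_cross_intersecting l t GG FF.
Proof.
move=> h F G Fi Gi Fin Gin; have := h G F Gi Fi Gin Fin.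
rewrite exchange_big /=; congr (_ <= _ + _).
by apply: eq_bigr => i _; apply: eq_bigr => j _; rewrite setIC.
Qed.

(** [l] members [G] whose intersections with the [F i] sum to at most [l * t - 1]
    would give a double sum of at most [l ^ 2 * t - l], one below the required
    [l ^ 2 * t - l + 1]. *)
Lemma card_deficient_lt n l t (FF GG : {set {set 'I_n}}) (F : 'I_l -> {set 'I_n}) :
  2 <= l -> 0 < t -> weakly_cross_intersecting l t FF GG ->
  injective F -> (forall i, F i \in FF) ->
  #|[set G in GG | \sum_(i < l) #|F i :&: G| < l * t]| < l.
Proof.
move=> l2 t0 h Fi Fin; rewrite ltnNge; apply/negP=> big.
have /card_gt1P[x [y [xS yS xy]]] := leq_trans l2 big.
have [G [Gi Gin _]] := exists_injective_tuple _ _ _ _ _ xS yS xy l2 big.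
have Gin' j : G j \in GG by have := Gin j; rewrite inE => /andP[].
have := h F G Fi Gi Fin Gin'; rewrite exchange_big /=.
have : \sum_(j < l) \sum_(i < l) #|F i :&: G j| <= \sum_(j < l) (l * t).-1.
  apply: leq_sum => j _; have := Gin j; rewrite inE => /andP[_ lt_j].
  by rewrite -ltnS (ltn_predK lt_j).
rewrite sum_nat_const card_ord => small; apply/negP; rewrite -ltnNge.
apply: (@leq_ltn_trans (l * (l * t).-1 + l)); first by rewrite leq_add2r.
by rewrite -mulnSr prednK ?muln_gt0 ?t0 ?(ltnW l2) // addn1 ltnS mulnA mulnn.
Qed.

(** Pigeonhole: a member of [GG] which is not deficient against a fixed
    [l]-tuple of [FF] contains a [t]-subset of one of the entries, and there are
    at most [l * 'C(k, t)] such subsets.  This is used twice: to bound a family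
    above by stars, and to find the centre of the star that contains it. *)
Lemma exists_popular_subset n k l t (FF GG : {set {set 'I_n}}) :
  2 <= l -> 0 < t -> weakly_cross_intersecting l t FF GG ->
  FF \subset ksubsets n k -> l <= #|FF| -> t <= k ->
  exists T : {set 'I_n}, #|T| = t /\
    #|GG| <= l.-1 + l * 'C(k, t) * #|[set G in GG | T \subset G]|.
Proof.
move=> l2 t0 h Fk lF tk.
have /card_gt1P[x [y [xS yS xy]]] := leq_trans l2 lF.
have [F [Fi Fin _]] := exists_injective_tuple _ _ _ _ _ xS yS xy l2 lF.
have Fc i : #|F i| = k by have := subsetP Fk _ (Fin i); rewrite inE => /eqP.
have := card_deficient_lt _ _ _ _ _ _ l2 t0 h Fi Fin.
set D := [set G in GG | _] => Dl.
pose UU := \bigcup_(i < l) [set U : {set 'I_n} | U \subset F i & #|U| == t].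
have UUle : #|UU| <= l * 'C(k, t).
  apply: leq_trans (card_bigcup_le _ _ _ _) _.
  rewrite (eq_bigr (fun=> 'C(k, t))); last by move=> i _; rewrite cards_draws Fc.
  by rewrite sum_nat_const card_ord.
have cov A : A \in GG :\: D -> exists2 U, U \in UU & U \subset A.
  rewrite !inE => /andP[+ AG]; rewrite AG /= -leqNgt => As.
  have [i ti] : exists i, t <= #|F i :&: A|.
    apply/existsP; apply: contraLR As; rewrite negb_exists => /forallP small.
    rewrite -ltnNge; apply: (@leq_ltn_trans (\sum_(i < l) t.-1)).
      by apply: leq_sum => i _; rewrite -ltnS prednK // ltnNge small.
    by rewrite sum_nat_const card_ord ltn_pmul2l ?(ltnW l2) // ltn_predL.
  have [U] := exists_subset_card _ _ _ ti; rewrite subsetI => /andP[UF UA] Ut.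
  by exists U => //; apply/bigcupP; exists i; rewrite // inE UF Ut eqxx.
(* A candidate is needed even when all of [GG] is deficient. *)
have [U0 U0U] : exists U, U \in UU.
  have [U UF Ut] : exists2 U : {set _}, U \subset F (Ordinal (ltnW l2)) & #|U| = t.
    by apply: exists_subset_card; rewrite Fc.
  by exists U; apply/bigcupP; exists (Ordinal (ltnW l2)); rewrite // inE UF Ut eqxx.
(* The most popular candidate is at least as popular as the average one. *)
pose T := [arg max_(U > U0 in UU) #|[set G in GG | U \subset G]|].
have [TU Tmax] : T \in UU /\ forall U, U \in UU ->
    #|[set G in GG | U \subset G]| <= #|[set G in GG | T \subset G]|.
  by rewrite /T; case: arg_maxnP.
exists T; split; first by case/bigcupP: TU => i _; rewrite inE => /andP[_ /eqP].
have -> : #|GG| = #|D| + #|GG :\: D|.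
  by rewrite -(cardsID D GG) (setIidPr _) // /D setIdE subsetIl.
apply: leq_add; first by lia.
apply: leq_trans (card_le_sum_containing _ _ _ cov) _.
apply: leq_trans (leq_mul UUle (leqnn _)); rewrite -sum_nat_const.
apply: leq_sum => U UUU; apply: leq_trans (Tmax U UUU); apply: subset_leq_card.
by apply/subsetP=> A; rewrite !inE => /andP[/andP[_ ->] ->].
Qed.

(** Complete [X] and [Y] to an [l]-tuple with [X = F a].  Discard the deficient
    [G] and, for each of the [l - 1] indices [i != a], the [G] that meet
    [F a :|: F i], a set of size at most [2 * k], in more than [t] points.  For
    the other [G], each of the [l] intersections has size at most [t] while
    they sum to at least [l * t], so each has size exactly [t]; since
    [G :&: (F a :|: F i)] also has size at most [t], it coincides with both
    [G :&: F a] and [G :&: F i].  Comparing with the single index [a], rather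
    than over all pairs of indices, keeps the factor [l - 1]. *)
Lemma card_distinguishing_le n k k' l t (FF GG : {set {set 'I_n}}) (X Y : {set 'I_n}) :
  2 <= l -> 0 < t -> t < k' -> weakly_cross_intersecting l t FF GG ->
  FF \subset ksubsets n k -> GG \subset ksubsets n k' -> l <= #|FF| ->
  X \in FF -> Y \in FF -> X != Y ->
  #|[set G in GG | ~~ ((G :&: X == G :&: Y) && (#|G :&: X| == t))]|
    <= l.-1 * ('C(2 * k, t.+1) * 'C(n - t.+1, k' - t.+1)).+1.
Proof.
move=> l2 t0 tk h Fk Gk lF XF YF XY.
have [F [Fi Fin [a [b [ab Fa Fb]]]]] := exists_injective_tuple _ _ _ _ _ XF YF XY l2 lF.
have Fc i : #|F i| = k by have := subsetP Fk _ (Fin i); rewrite inE => /eqP.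
have := card_deficient_lt _ _ _ _ _ _ l2 t0 h Fi Fin.
set D := [set G in GG | _] => Dl.
pose E i := [set G in GG | t.+1 <= #|G :&: (F a :|: F i)|].
have Ele i : #|E i| <= 'C(2 * k, t.+1) * 'C(n - t.+1, k' - t.+1).
  apply: (@card_meeting_le _ _ _ _ (F a :|: F i)) => //.
  - by apply: subset_trans Gk; rewrite /E setIdE subsetIl.
  - by apply: leq_trans (leq_card_setU _ _) _; rewrite !Fc; lia.
  - by move=> A; rewrite inE => /andP[].
have sub : [set G in GG | ~~ ((G :&: X == G :&: Y) && (#|G :&: X| == t))]
    \subset D :|: \bigcup_(i | i != a) E i.
  apply/subsetP=> G; rewrite inE => /andP[GGG]; apply: contraR.
  rewrite inE negb_or [G \in D]inE GGG /= -leqNgt => /andP[Gsum GE].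
  have GEi i : i != a -> #|G :&: (F a :|: F i)| <= t.
    move=> ia; rewrite leqNgt; apply: contra GE => Gi.
    by apply/bigcupP; exists i; rewrite // inE GGG.
  have small i : #|F i :&: G| <= t.
    have [->|ia] := eqVneq i a.
      apply: leq_trans (GEi b _); last by rewrite eq_sym.
      by rewrite setIC subset_leq_card // setIS // subsetUl.
    apply: leq_trans (GEi i ia).
    by rewrite setIC subset_leq_card // setIS // subsetUr.
  have eqt i : #|F i :&: G| = t.
    apply/eqP; rewrite eqn_leq small /=; rewrite leqNgt; apply/negP=> lt_i.
    have : \sum_(i < l) #|F i :&: G| < \sum_(i < l) t.
      rewrite (bigD1 i) //= [ltnRHS](bigD1 i) //= -addSn leq_add //.
      exact: leq_sum.
    by rewrite sum_nat_const card_ord ltnNge Gsum.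
  have ba : b != a by rewrite eq_sym.
  have cut i : i \in [:: a; b] -> G :&: F i = G :&: (F a :|: F b).
    move=> iab; apply/eqP; rewrite eqEcard setIS /=.
      by rewrite (setIC _ (F i)) eqt GEi.
    by move: iab; rewrite !inE => /orP[]/eqP->; rewrite ?subsetUl ?subsetUr.
  by rewrite -Fa -Fb !cut ?inE ?eqxx ?orbT //= -(cut a) ?inE ?eqxx // setIC eqt.
apply: leq_trans (subset_leq_card sub) _.
apply: leq_trans (leq_card_setU _ _) _; rewrite mulnS; apply: leq_add; first by lia.
apply: leq_trans (card_bigcup_le _ _ _ _) _.
apply: (leq_trans (leq_sum _ (fun i _ => Ele i))).
by rewrite sum_nat_const (cardC1 a) card_ord.
Qed.

(** * Families with a large product *)

(** The popular subset bounds [#|GG|] by [2 * l * 'C(q, t)] times the size [P']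
    of a star, hence [#|FF|] is at least [P / (2 * l * 'C(q, t))], and
    [P = (n - t) / (k - t) * N] where [N = 'C(n - t.+1, k - t.+1)] counts the
    [k]-sets through a fixed set of [t + 1] points.  The parameter [q] is a
    common bound for [k] and [k'], so that the lemma applies to either
    family. *)
Lemma card_family_ge n k k' l t (FF GG : {set {set 'I_n}}) q :
  2 <= l -> 0 < t -> weakly_cross_intersecting l t FF GG ->
  FF \subset ksubsets n k -> GG \subset ksubsets n k' -> l <= #|FF| ->
  t < k -> t < k' -> k <= q -> k' <= q -> q <= n ->
  q ^ 2 * l ^ 4 * 'C(2 * q, t.+1) * 'C(q, t) <= 2 * (n - t) ->
  'C(n - t, k - t) * 'C(n - t, k' - t) <= #|FF| * #|GG| ->
  l ^ 2 * 'C(2 * q, t.+1) * 'C(n - t.+1, k - t.+1) <= #|FF|.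
Proof.
move=> l2 t0 h Fk Gk lF tk tk' kq k'q qn hn big.
have [T [Tt]] := exists_popular_subset _ _ _ _ _ _ l2 t0 h Fk lF (ltnW tk).
set x := #|FF| in big *; set y := #|GG| in big * => yle.
set P := 'C(n - t, k - t) in big.
set P' := 'C(n - t, k' - t) in big.
set N := 'C(n - t.+1, k - t.+1).
set A := 'C(2 * q, t.+1) in hn *; set C := 'C(q, t) in hn *.
have GT : #|[set G in GG | T \subset G]| <= P'.
  rewrite /P' -Tt -card_kstar ?Tt ?(ltnW tk') //; apply: subset_leq_card.
  by apply/subsetP=> G; rewrite !inE => /andP[/(subsetP Gk)]; rewrite inE => -> ->.
have P'0 : 0 < P' by rewrite bin_gt0; lia.
have C0 : 0 < C by rewrite bin_gt0; lia.
have yle' : y <= 2 * l * C * P'.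
  apply: leq_trans yle _.
  have : 'C(k, t) * #|[set G in GG | T \subset G]| <= C * P'.
    by rewrite leq_mul // leq_bin2l.
  have : 0 < C * P' by rewrite muln_gt0 C0.
  rewrite -!mulnA; move: (C * P') (_ * _) => c d; nia.
have Pxle : P <= 2 * l * C * x.
  rewrite -(leq_pmul2r P'0); apply: leq_trans big _.
  by rewrite mulnC [leqRHS]mulnAC leq_mul2r yle' orbT.
have PN : (n - t) * N = (k - t) * P.
  rewrite /P /N !subnS; have [m km] : exists m, k - t = m.+1 by exists (k - t).-1; lia.
  by rewrite km mul_bin_diag.
have l0 : 0 < l := ltnW l2.
(* Multiplying by [q * (l * C)] makes the left-hand side the lower bound on
   [2 * (n - t)], times [N]. *)
have key : q * l * l ^ 2 * A * N <= 4 * x.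
  rewrite -(@leq_pmul2r (q * (l * C))); last by rewrite !muln_gt0 l0 C0; lia.
  apply: (@leq_trans (2 * ((n - t) * N))).
    rewrite [leqRHS]mulnA; apply: leq_trans (leq_mul hn (leqnn N)).
    by apply/eq_leq; rewrite !expnS !expn0; ring.
  rewrite PN; apply: (@leq_trans (2 * (q * (2 * l * C * x)))); last by apply/eq_leq; ring.
  by rewrite leq_mul2l leq_mul //; lia.
have q2 : 2 <= q by lia.
have ql : 4 <= q * l := leq_mul q2 l2.
rewrite -(@leq_pmul2l 4) //; apply: leq_trans key.
have -> : q * l * l ^ 2 * A * N = q * l * (l ^ 2 * A * N) by ring.
by rewrite leq_mul2r ql orbT.
Qed.

(** The centre [T] is popular in [FF].  The three size hypotheses serve, in
    order, to find two members of [FF] that meet exactly in [T], to transfer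
    [T] from [FF] to [GG], and to find a [G] outside two exceptional sets at the
    same time. *)
Lemma cross_families_in_stars n k k' l t (FF GG : {set {set 'I_n}}) :
  2 <= l -> 0 < t -> t < k -> t < k' -> weakly_cross_intersecting l t FF GG ->
  FF \subset ksubsets n k -> GG \subset ksubsets n k' ->
  l <= #|FF| -> l <= #|GG| ->
  l.-1 + l * 'C(k', t) * ((k - t) * 'C(n - t.+1, k - t.+1)) < #|FF| ->
  l.-1 * ('C(2 * k', t.+1) * 'C(n - t.+1, k - t.+1)).+1 < #|FF| ->
  2 * (l.-1 * ('C(2 * k, t.+1) * 'C(n - t.+1, k' - t.+1)).+1) < #|GG| ->
  exists T : {set 'I_n}, [/\ #|T| = t, FF \subset kstar k T & GG \subset kstar k' T].
Proof.
move=> l2 t0 tk tk' h Fk Gk lF lG Fpop Fbig Gbig.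
have h' := weakly_cross_sym _ _ _ _ _ h.
have Fc F : F \in FF -> #|F| = k by move/(subsetP Fk); rewrite inE => /eqP.
have [T [Tt Tpop]] := exists_popular_subset _ _ _ _ _ _ l2 t0 h' Gk lG (ltnW tk').
set N := 'C(n - t.+1, k - t.+1) in Fpop Fbig.
set FT := [set F in FF | T \subset F] in Tpop.
have FTbig : (k - t) * N < #|FT|.
  have := leq_trans Fpop Tpop; rewrite ltn_add2l ltn_pmul2l //.
  by rewrite muln_gt0 bin_gt0 (ltnW l2) ltnW.
have [F1] : exists F, F \in FT by apply/card_gt0P; apply: leq_ltn_trans FTbig.
rewrite inE => /andP[F1F TF1].
have [F2 [F2F F12]] : exists F2, F2 \in FF /\ F1 :&: F2 = T.
  (* The members of [FT] that meet [F1] outside [T], including [F1] itself,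
     contain one of the [k - t] sets [x |: T]; they cannot exhaust [FT]. *)
  pose R := [set F in FT | F1 :&: F != T].
  suff /exists_of_card_failing_lt [F2] : #|R| < #|FT|.
    by rewrite inE => /andP[F2F _] /eqP; exists F2.
  apply: leq_ltn_trans FTbig.
  pose UU := [set x |: T | x in F1 :\: T].
  apply: (@leq_trans (\sum_(U in UU) #|[set A in R | U \subset A]|)).
    apply: card_le_sum_containing => F; rewrite !inE -andbA => /and3P[FF' TF neq].
    have : T \proper F1 :&: F by rewrite properEneq eq_sym neq subsetI TF1.
    case/properP=> _ [x]; rewrite inE => /andP[xF1 xF] xT.
    exists (x |: T); last by rewrite subUset sub1set xF.
    by apply: imset_f; rewrite inE xT.
  apply: (@leq_trans (\sum_(U in UU) N)).
    apply: leq_sum => _ /imsetP[x + ->]; rewrite inE => /andP[xT _].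
    have xTc : #|x |: T| = t.+1 by rewrite cardsU1 xT Tt.
    rewrite /N -xTc -card_kstar ?xTc //; apply: subset_leq_card.
    by apply/subsetP=> F; rewrite !inE -!andbA => /and4P[/Fc -> _ _ ->]; rewrite eqxx.
  rewrite sum_nat_const leq_mul2r (leq_trans (leq_imset_card _ _)) ?orbT //.
  by rewrite cardsD (setIidPr TF1) Tt Fc.
have F1F2 : F1 != F2.
  by apply/eqP=> E; move: F12; rewrite -E setIid => E1; move: tk; rewrite -Tt -E1 Fc ?ltnn.
have cut G : (G :&: F1 == G :&: F2) && (#|G :&: F1| == t) -> G :&: F1 = T.
  case/andP=> /eqP E /eqP c; apply/eqP; rewrite eqEcard Tt c leqnn andbT.
  by rewrite -F12 subsetI subsetIr E subsetIr.
have D12 := card_distinguishing_le _ _ _ _ _ _ _ _ _ l2 t0 tk' h Fk Gk lF F1F F2F F1F2.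
have starF F0 : F0 \in FF -> T \subset F0.
  move=> F0F; have [<-//|F10] := eqVneq F1 F0.
  have D10 := card_distinguishing_le _ _ _ _ _ _ _ _ _ l2 t0 tk' h Fk Gk lF F1F F0F F10.
  have /exists_of_card_failing_lt[G _ /andP[/cut G1 /andP[/eqP G0 _]]] :
    #|[set G in GG | ~~ ((G :&: F1 == G :&: F2) && (#|G :&: F1| == t)
       && ((G :&: F1 == G :&: F0) && (#|G :&: F1| == t)))]| < #|GG|.
    apply: leq_ltn_trans Gbig; rewrite mul2n -addnn.
    apply: leq_trans (leq_add D12 D10); apply: leq_trans (leq_card_setU _ _).
    apply: subset_leq_card; apply/subsetP=> G; rewrite !inE.
    by case/andP=> ->; rewrite negb_and.
  by rewrite -G1 G0 subsetIr.
have [G1 G1G /cut G1F1] : exists2 G, G \in GG &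
    (G :&: F1 == G :&: F2) && (#|G :&: F1| == t).
  apply: exists_of_card_failing_lt; apply: leq_ltn_trans D12 _; apply: leq_ltn_trans Gbig.
  by rewrite leq_pmull.
have TG1 : T \subset G1 by rewrite -G1F1 subsetIl.
have starG G0 : G0 \in GG -> T \subset G0.
  move=> G0G; have [<-//|G10] := eqVneq G1 G0.
  have D10 := card_distinguishing_le _ _ _ _ _ _ _ _ _ l2 t0 tk h' Gk Fk lG G1G G0G G10.
  have [F FinF /andP[/eqP E /eqP c]] := exists_of_card_failing_lt _ _ _ (leq_ltn_trans D10 Fbig).
  have -> : T = F :&: G1 by apply/eqP; rewrite eqEcard c Tt leqnn subsetI TG1 starF.
  by rewrite E subsetIr.
exists T; split=> //; apply/subsetP=> A AA; rewrite inE.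
  by rewrite (subsetP Fk) ?starF.
by rewrite (subsetP Gk) ?starG.
Qed.

(* The hypotheses hFl and hGl exclude the case where the intersection condition
   is vacuous, in which the bound can fail: for k = k' = 3, t = 2, l = 2, take
   one 3-set for FF and all 3-sets for GG. *)
Theorem theorem1p5 (k k' l t n : nat) (FF GG : {set {set 'I_n}})
  (ht : 0 < t) (hk' : t + 1 <= k') (hk : k' <= k) (hl : 2 <= l)
  (hn : ((k ^ 2 * l ^ 4)%:R / 2%:R * 'C(2 * k, t + 1)%:R * 'C(k, t)%:R + t%:R
          <= n%:R :> rat)%R)
  (hF : FF \subset ksubsets n k) (hG : GG \subset ksubsets n k')
  (hFl : l <= #|FF|) (hGl : l <= #|GG|)
  (hFG : weakly_cross_intersecting l t FF GG) :
  #|FF| * #|GG| <= 'C(n - t, k - t) * 'C(n - t, k' - t) /\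
  (#|FF| * #|GG| = 'C(n - t, k - t) * 'C(n - t, k' - t) ->
   exists T : {set 'I_n},
     [/\ #|T| = t, FF = kstar k T & GG = kstar k' T]).
Proof.
rewrite addn1 in hk'; have tk : t < k := leq_trans hk' hk.
have hn' : k ^ 2 * l ^ 4 * 'C(2 * k, t.+1) * 'C(k, t) + 2 * t <= 2 * n.
  rewrite -(ler_nat rat) !natrD !natrM; rewrite addn1 !natrM in hn.
  lra.
have l0 : 0 < l := ltnW hl.
have C0 : 0 < 'C(k, t) by rewrite bin_gt0 ltnW.
(* One term of Vandermonde's sum over the splittings of [t + 1] as [1 + t]. *)
have kC : k * 'C(k, t) <= 'C(2 * k, t.+1).
  rewrite mul2n -addnn -binomial.Vandermonde (bigD1 (inord 1)) //= inordK // bin1 subn1.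
  exact: leq_addr.
have A2 : 2 <= 'C(2 * k, t.+1).
  by apply: leq_trans kC; apply: leq_trans (leq_pmulr k C0); apply: leq_trans tk.
have hn2 : k ^ 2 * l ^ 4 * 'C(2 * k, t.+1) * 'C(k, t) <= 2 * (n - t) by lia.
have kn : k <= n.
  have : 2 * k <= k ^ 2 * l ^ 4 * 'C(2 * k, t.+1) * 'C(k, t).
    rewrite -(mulnA (k ^ 2 * l ^ 4)) [leqLHS]mulnC; apply: leq_mul.
      by rewrite -mulnn -[X in _ <= X]mulnA leq_pmulr // muln_gt0 expn_gt0 l0 andbT; lia.
    by apply: leq_trans A2 _; rewrite leq_pmulr.
  lia.
have stars : 'C(n - t, k - t) * 'C(n - t, k' - t) <= #|FF| * #|GG| ->
    exists T : {set 'I_n}, [/\ #|T| = t, FF \subset kstar k T & GG \subset kstar k' T].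
  move=> big.
  have Fge := card_family_ge _ _ _ _ _ _ _ _ hl ht hFG hF hG hFl tk hk' (leqnn k) hk kn hn2 big.
  rewrite mulnC [leqRHS]mulnC in big.
  have Gge := card_family_ge _ _ _ _ _ _ _ _ hl ht (weakly_cross_sym _ _ _ _ _ hFG)
    hG hF hGl hk' tk hk (leqnn k) kn hn2 big.
  have N0 : 0 < 'C(n - t.+1, k - t.+1) by rewrite bin_gt0; lia.
  have N'0 : 0 < 'C(n - t.+1, k' - t.+1) by rewrite bin_gt0; lia.
  have C'C : 'C(k', t) <= 'C(k, t) by rewrite leq_bin2l.
  have A'A : 'C(2 * k', t.+1) <= 'C(2 * k, t.+1) by rewrite leq_bin2l // leq_mul.
  apply: (cross_families_in_stars _ _ _ _ _ _ _ hl ht tk hk' hFG hF hG hFl hGl).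
  - apply: leq_trans Fge.
    have : 'C(k', t) * (k - t) <= 'C(2 * k, t.+1).
      by apply: leq_trans kC; rewrite mulnC leq_mul // leq_subr.
    move=> c; have : 'C(k', t) * ((k - t) * 'C(n - t.+1, k - t.+1)) <=
       'C(2 * k, t.+1) * 'C(n - t.+1, k - t.+1) by rewrite mulnA leq_mul.
    have : 2 <= 'C(2 * k, t.+1) * 'C(n - t.+1, k - t.+1) by nia.
    rewrite -(mulnA l) -(mulnA (l ^ 2)) -mulnn; move: (_ * (_ * _)) (_ * 'C(n - _, _)) => u v; nia.
  - apply: leq_trans Fge.
    have : 'C(2 * k', t.+1) * 'C(n - t.+1, k - t.+1) <=
       'C(2 * k, t.+1) * 'C(n - t.+1, k - t.+1) by rewrite leq_mul.
    have : 2 <= 'C(2 * k, t.+1) * 'C(n - t.+1, k - t.+1) by nia.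
    rewrite -(mulnA (l ^ 2)) -mulnn; move: ('C(2 * k', _) * _) ('C(2 * k, _) * _) => u v; nia.
  - apply: leq_trans Gge.
    have : 2 <= 'C(2 * k, t.+1) * 'C(n - t.+1, k' - t.+1) by nia.
    rewrite -(mulnA (l ^ 2)) -mulnn; move: ('C(2 * k, _) * _) => u; nia.
have sizes (T : {set 'I_n}) m (AA : {set {set 'I_n}}) :
    #|T| = t -> t <= m -> AA \subset kstar m T ->
    #|AA| <= 'C(n - t, m - t) ?= iff (AA == kstar m T).
  move=> Tt tm sub; rewrite -Tt -card_kstar ?Tt //; exact: subset_leqif_cards.
have tk'W := ltnW hk'; have tkW := ltnW tk.
have [small|/stars[T [Tt TF TG]]] := ltnP (#|FF| * #|GG|) ('C(n - t, k - t) * 'C(n - t, k' - t)).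
  by split; [exact: ltnW | move=> E; rewrite E ltnn in small].
have [Fle Feq] := sizes T k FF Tt tkW TF.
have [Gle Geq] := sizes T k' GG Tt tk'W TG.
split; first exact: leq_mul.
have P0 : 0 < 'C(n - t, k - t) by rewrite bin_gt0; lia.
have P'0 : 0 < 'C(n - t, k' - t) by rewrite bin_gt0; lia.
move=> E; exists T; split=> //; apply/eqP; [rewrite -Feq | rewrite -Geq].
  by rewrite eqn_leq Fle -(leq_pmul2r P'0) -E leq_mul //.
by rewrite eqn_leq Gle -(leq_pmul2l P0) -E leq_mul.
Qed.
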